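(* Let $a\in\{1,2\}$ and let $n,m,k$ be integers with $1\le m\le n$, $2\le k\le 2a3^{m-1}+1$ and $k<a3^m$. Then $$v_3\big(s(a3^n,a3^m-k)\big)=\frac{a}{2}(3^n-3^m)-(n-m)(a3^m-k)+m-1-v_3\Big(\Big\lfloor\frac{k}{2}\Big\rfloor\Big)+(m+v_3(k))\epsilon_k .$$
   Context: For integers $N\ge 1$ and $K\ge 0$, $s(N,K)$ denotes the (unsigned) Stirling number of the first kind, i.e. the number of permutations of $N$ elements with exactly $K$ disjoint cycles; equivalently $x(x-1)\cdots(x-N+1)=\sum_{K=0}^N(-1)^{N-K}s(N,K)x^K$. For a nonzero integer $x$, $v_3(x)$ is the largest integer $r\ge0$ with $3^r\mid x$. $\lfloor x\rfloor$ is the floor of $x$. $\epsilon_k=0$ if $k$ is even and $\epsilon_k=1$ if $k$ is odd. *)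

(* Defs.v *)
From mathcomp Require Import all_boot all_order all_algebra all_fingroup.

Set Implicit Arguments.
Unset Strict Implicit.
Unset Printing Implicit Defensive.

(* Unsigned Stirling numbers of the first kind. [porbits p] contains the
   singleton orbits, so fixed points count as cycles. *)
Definition stirling1 (N K : nat) : nat :=
  #|[set p : 'S_N | #|porbits p| == K]|.

Definition eps (k : nat) : nat := if odd k then 1 else 0.

(* Main.v *)
(** Write [N = a 3^n], [M = a 3^m], [c = n - m].  Substituting [y = 2x + N] in
    [x (x+1) ... (x+N-1)] centres it: it becomes, up to the factor [2^N], the
    product [U_n(y)] of the [y + 2i - N], which is [y - N] times a polynomial
    that is even or odd.  Splitting off the [i] prime to 3 gives
    [U_{n+1}(3y) = 3^N U_n(y) Q_{n+1}(3y)], and since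
    [f(y-h) f(y) f(y+h) = f(y)^3 mod h^2], induction shows that
    [U_m = (y^3 - y)^(M/3)] and [Q_m = (y^2 - 1)^(M/3)] modulo [3^m].  Hence
    [U_n(3^c y) = 3^((N-M)/2) U_m(y) R(y)] with [R = +-1 mod 3^m], and, since
    [N = 3^c M], replacing [x] by [3^c x] turns [y] into [3^c (2x + M)].  The
    coefficients of [x^K] then express [s(N, K)] by the Taylor coefficients at [M]
    of a polynomial [B = U_m R / (y - M)] whose coefficients modulo [3^m] are
    binomials [C(M/3, e)].  For [k] even the constant Taylor term dominates; for
    [k] odd it vanishes by parity and the linear one dominates. *)

Require Import Defs.
From mathcomp Require Import all_boot all_order all_algebra all_fingroup.
From mathcomp Require Import ring lra zify.
Import Order.TTheory GRing.Theory Num.Theory.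
Local Open Scope ring_scope.

(** * Cycle counts and the rising factorial *)

Lemma porbit_lift_perm n (i : 'I_n.+1) (q : 'S_n) x :
  porbit (lift_perm i i q) (lift i x) = lift i @: porbit q x.
Proof.
have liftX k : (lift_perm i i q ^+ k)%g = lift_perm i i (q ^+ k)%g.
  by elim: k => [|k IHk]; rewrite ?expg0 ?lift_perm1 // !expgS IHk lift_permM.
apply/setP => y; apply/idP/imsetP => [/porbitP[k ->]|[z /porbitP[k ->] ->]].
  by exists ((q ^+ k)%g x); rewrite ?mem_porbit // liftX lift_perm_lift.
by rewrite -(lift_perm_lift i i) -liftX mem_porbit.
Qed.

Lemma porbit_lift_perm_id n (i : 'I_n.+1) (q : 'S_n) :
  porbit (lift_perm i i q) i = [set i].
Proof.
have liftX k : (lift_perm i i q ^+ k)%g i = i.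
  by elim: k => [|k IHk]; rewrite ?expg0 ?perm1 // expgSr permM IHk lift_perm_id.
apply/setP => y; rewrite inE; apply/idP/eqP => [/porbitP[k ->] //|->].
exact: porbit_id.
Qed.

Lemma card_porbits_lift_perm n (i : 'I_n.+1) (q : 'S_n) :
  #|porbits (lift_perm i i q)| = #|porbits q|.+1.
Proof.
have -> : porbits (lift_perm i i q) =
    [set i] |: (fun X : {set 'I_n} => lift i @: X) @: porbits q.
  apply/setP => X; rewrite !inE; apply/imsetP/orP => [[x _ ->]|].
    case: (unliftP i x) => [j|] ->; [right | by left; rewrite porbit_lift_perm_id].
    by rewrite porbit_lift_perm imset_f // imset_f.
  case=> [/eqP-> | /imsetP[Y /imsetP[x _ ->] ->]].
    by exists i; rewrite ?porbit_lift_perm_id.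
  by exists (lift i x); rewrite ?porbit_lift_perm.
rewrite cardsU1 card_imset; last exact/imset_inj/lift_inj.
case: imsetP => // [[Y _ /setP/(_ i)]].
rewrite inE eqxx => /esym/imsetP[x _ /eqP].
by rewrite (negPf (neq_lift _ _)).
Qed.

(** The component [iq.1] is the preimage of [ord_max]; [iq.2] is what remains once [ord_max] is
    deleted from its cycle. *)
Definition insert_perm {n} (iq : 'I_n.+1 * 'S_n) : 'S_n.+1 :=
  (tperm ord_max iq.1 * lift_perm ord_max ord_max iq.2)%g.

Lemma insert_perm_bij n : bijective (@insert_perm n).
Proof.
apply: inj_card_bij => [[i q] [j r]|]; last first.
  by rewrite card_prod card_ord !card_Sn factS.
rewrite /insert_perm /= => eq_p.
have eq_ij : i = j.
  have := congr1 (fun p : 'S_n.+1 => (p^-1)%g ord_max) eq_p.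
  by rewrite !invMg !permM !tpermV !lift_permV !lift_perm_id !tpermL.
rewrite -eq_ij in eq_p *; move/mulgI: eq_p => eq_l; congr (_, _).
apply/permP => x; have := congr1 (fun p : 'S_n.+1 => p (lift ord_max x)) eq_l.
by rewrite !lift_perm_lift => /lift_inj.
Qed.

(** The lifted permutation has the extra cycle [[set ord_max]]; a transposition with [i != ord_max]
    merges it into the cycle of [i]. *)
Lemma card_porbits_insert_perm n (i : 'I_n.+1) (q : 'S_n) :
  #|porbits (insert_perm (i, q))| = (#|porbits q| + (i == ord_max))%N.
Proof.
have := porbits_mul_tperm (lift_perm ord_max ord_max q) ord_max i.
rewrite /= card_porbits_lift_perm porbit_sym porbit_lift_perm_id inE.
rewrite /insert_perm /= (eq_sym ord_max); move: #|porbits (_ * _)| #|porbits q| => u v; case: (i == ord_max) => /=; lia.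
Qed.

Lemma prod_XaddC_porbits n :
  \prod_(0 <= i < n) ('X + i%:R) = \sum_(p : 'S_n) 'X^#|porbits p| :> {poly int}.
Proof.
elim: n => [|n IHn].
  rewrite big_geq // (eq_bigr (fun=> 1)) ?sumr_const ?card_Sn // => p _.
  rewrite (_ : porbits p = set0) ?cards0 ?expr0 //.
  by apply/setP => X; rewrite inE; apply/imsetP => [[[]]].
rewrite big_nat_recr //= IHn (reindex _ (onW_bij _ (insert_perm_bij n))) /=.
rewrite -(pair_bigA _ (fun i q => 'X^#|porbits (insert_perm (i, q))|)) /=.
rewrite exchange_big mulr_suml; apply: eq_bigr => q _ /=.
under eq_bigr => i _ do rewrite card_porbits_insert_perm.
(* The choice [i = ord_max] creates a cycle and yields the summand ['X] of the new factor; the other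
   [n] choices yield [n%:R]. *)
rewrite big_ord_recr /= eqxx addn1 exprSr mulrDr addrC; congr (_ + _).
rewrite (eq_bigr (fun=> 'X^#|porbits q|)) => [|i _].
  by rewrite sumr_const card_ord mulr_natr.
by rewrite -val_eqE /= (ltn_eqF (ltn_ord i)) addn0.
Qed.

Lemma coef_prod_XaddC n k :
  (\prod_(0 <= i < n) ('X + i%:R) : {poly int})`_k = (stirling1 n k)%:R.
Proof.
rewrite prod_XaddC_porbits coef_sum /stirling1 -sum1_card natr_sum big_mkcond /=.
rewrite [RHS]big_mkcond /=.
by apply: eq_bigr => p _; rewrite inE coefXn eq_sym; case: eqP.
Qed.

(** * Congruences modulo powers of 3 *)

Definition cong {R : comNzRingType} (d x y : R) := exists h, x = y + d * h.

Lemma cong_refl {R : comNzRingType} (d x : R) : cong d x x.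
Proof. by exists 0; ring. Qed.

Lemma cong_trans {R : comNzRingType} (d x y z : R) :
  cong d x y -> cong d y z -> cong d x z.
Proof. by move=> [h ->] [g ->]; exists (g + h); ring. Qed.

Lemma congM {R : comNzRingType} (d x y z t : R) :
  cong d x y -> cong d z t -> cong d (x * z) (y * t).
Proof. by move=> [h ->] [g ->]; exists (y * g + h * t + d * h * g); ring. Qed.

Lemma congX {R : comNzRingType} (d x y : R) k :
  cong d x y -> cong d (x ^+ k) (y ^+ k).
Proof.
move=> xy; elim: k => [|k IHk]; first exact: cong_refl.
by rewrite !exprS; apply: congM.
Qed.

Lemma cong_dvd {R : comNzRingType} (d e x y : R) : cong (d * e) x y -> cong d x y.
Proof. by case=> h ->; exists (e * h); ring. Qed.

Lemma cong_comp {R : comNzRingType} (n : nat) (f g p : {poly R}) :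
  cong (3 ^+ n) f g -> cong (3 ^+ n) (f \Po p) (g \Po p).
Proof.
case=> h ->; exists (h \Po p).
by rewrite comp_polyD comp_polyM rmorphXn rmorph_nat.
Qed.

(** Cubing gains a factor 3: the mixed terms get it from the binomial coefficient, the term in
    [h ^+ 3] from the exponent being at least 1. *)
Lemma cong_cube {R : comNzRingType} (n : nat) (x y : R) :
  cong (3 ^+ n.+1) x y -> cong (3 ^+ n.+2) (x ^+ 3) (y ^+ 3).
Proof.
case=> h ->; exists (y ^+ 2 * h + 3 ^+ n.+1 * y * h ^+ 2 + 3 ^+ n * 3 ^+ n.+1 * h ^+ 3).
by rewrite !exprS; ring.
Qed.

Lemma cong_exp3 {R : comNzRingType} (n : nat) (x y : R) :
  cong 3 x y -> cong (3 ^+ n.+1) (x ^+ (3 ^ n)) (y ^+ (3 ^ n)).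
Proof.
by move=> xy; elim: n => [|n /cong_cube]; rewrite ?expr1 // -!exprM -expnSr.
Qed.

(** * Centred products under shifts, tripling and reflection *)

Lemma comp_poly_Xadd_taylor {R : comNzRingType} (h f : {poly R}) :
  exists a b c, f \Po ('X + h) = f + h * a + h ^+ 2 * b /\
                f \Po ('X - h) = f - h * a + h ^+ 2 * c.
Proof.
elim/poly_ind: f => [|f x [a [b [c [fD fB]]]]].
  by exists 0, 0, 0; rewrite !comp_poly0; split; ring.
exists (f + a * 'X), (a + b * ('X + h)), (a + c * ('X - h)).
by rewrite !comp_poly_MXaddC fD fB; split; ring.
Qed.

(** Both shifts share the linear coefficient [a] with opposite signs, so the terms of first order in
    [h] cancel. *)
Lemma comp_poly_shifts_cube {R : comNzRingType} (h f : {poly R}) :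
  cong (h ^+ 2) ((f \Po ('X - h)) * f * (f \Po ('X + h))) (f ^+ 3).
Proof.
have [a [b [c [-> ->]]]] := comp_poly_Xadd_taylor h f.
by exists (f * (f * (b + c) - a ^+ 2 + h * a * (c - b) + h ^+ 2 * b * c)); ring.
Qed.

(* The constants [2i - N], for [0 < i < N], are symmetric about 0. *)
Definition clin (N i : nat) : {poly int} := 'X + ((2 * i)%:R - N%:R).

Definition clin_prod (P : pred nat) (N : nat) : {poly int} :=
  \prod_(0 <= i < N | P i) clin N i.

Lemma clin_comp N M i j (p : {poly int}) :
  p + (2 * i)%:R - N%:R = 'X + (2 * j)%:R - M%:R -> clin N i \Po p = clin M j.
Proof.
by move=> e; rewrite /clin comp_polyD comp_polyX rmorphB !rmorph_nat !addrA.
Qed.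

(** The range is cut into three blocks of length [N], whose constants are centred at [-2N], [0] and
    [2N]. *)
Lemma clin_prod_triple (P : pred nat) N : (forall i, P (N + i)%N = P i) ->
  clin_prod P (3 * N) =
    (clin_prod P N \Po ('X - (2 * N)%:R)) * clin_prod P N * (clin_prod P N \Po ('X + (2 * N)%:R)).
Proof.
move=> PN; rewrite /clin_prod !rmorph_prod.
have le12 : (N <= 2 * N)%N by lia.
have le23 : (2 * N <= 3 * N)%N by lia.
rewrite (big_cat_nat (leq0n N) (leq_trans le12 le23)) (big_cat_nat le12 le23).
rewrite [LHS]mulrA; congr (_ * _ * _).
- by apply: eq_bigr => i _; rewrite /= (@clin_comp _ (3 * N) _ i) // ?natrM; ring.
- rewrite -{1}[N]add0n big_addn (_ : (2 * N - N = N)%N); last lia.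
  apply: eq_big => [i|i _]; first by rewrite addnC PN.
  by rewrite /clin !natrM natrD; ring.
rewrite -{1}[(2 * N)%N]add0n big_addn (_ : (3 * N - 2 * N = N)%N); last lia.
apply: eq_big => [i|i _]; first by rewrite mul2n -addnn addnC -addnA !PN.
by rewrite /= (@clin_comp _ (3 * N) _ (i + 2 * N)) // !natrM natrD natrM; ring.
Qed.

(** Each tripling replaces the product by its cube up to the square of the shift [2 a 3^(n+1)],
    which is divisible by [3^(n+2)]; cubing the induction hypothesis gains the same power. Only the
    case modulo 3 has to be computed. *)
Lemma clin_prod_cong (P : pred nat) a n V :
  (forall i, P (3 + i)%N = P i) -> cong 3 (clin_prod P (a * 3)) V ->
  cong (3 ^+ n.+1) (clin_prod P (a * 3 ^ n.+1)) (V ^+ (3 ^ n)).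
Proof.
move=> P3 PV; elim: n => [|n IHn]; first by rewrite !expr1.
have PN i : P (a * 3 ^ n.+1 + i)%N = P i.
  rewrite expnSr mulnA mulnC; elim: (a * 3 ^ n)%N => // k IHk.
  by rewrite mulnS -addnA P3.
rewrite [in clin_prod _ _]expnS mulnCA clin_prod_triple //.
apply: (@cong_trans _ _ _ (clin_prod P (a * 3 ^ n.+1) ^+ 3)).
  apply: (@cong_dvd _ _ (4 * a%:R ^+ 2 * 3 ^+ n)).
  have -> : 3 ^+ n.+2 * (4 * a%:R ^+ 2 * 3 ^+ n) = (2 * (a * 3 ^ n.+1))%:R ^+ 2 :> {poly int}.
    by rewrite !natrM natrX !exprS; ring.
  exact: comp_poly_shifts_cube.
by rewrite [in V ^+ _]expnSr exprM; apply: cong_cube.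
Qed.

Lemma clin_prodT_cong a n : a = 1%N \/ a = 2%N ->
  cong (3 ^+ n.+1) (clin_prod xpredT (a * 3 ^ n.+1)) (('X ^+ 3 - 'X) ^+ (a * 3 ^ n)).
Proof.
move=> ha; rewrite exprM; apply: clin_prod_cong => //.
case: ha => ->; rewrite /clin_prod /index_iota /= !big_cons big_nil /clin.
  by exists (1 - 'X ^+ 2); ring.
by exists (- 2 * 'X ^+ 5 - 6 * 'X ^+ 4 + 40 * 'X ^+ 3 + 21 * 'X ^+ 2 - 128 * 'X); ring.
Qed.

Lemma clin_prod_coprime3_cong a n : a = 1%N \/ a = 2%N ->
  cong (3 ^+ n.+1) (clin_prod (fun i => ~~ (3 %| i)%N) (a * 3 ^ n.+1))
    (('X ^+ 2 - 1) ^+ (a * 3 ^ n)).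
Proof.
move=> ha; rewrite exprM; apply: clin_prod_cong => [i|]; first by rewrite dvdn_addr.
case: ha => ->; rewrite /clin_prod /index_iota /= !big_cons big_nil /= /clin.
  by exists 0; ring.
by exists (21 - 6 * 'X ^+ 2); ring.
Qed.

Lemma prod_dvdn3 (R : comNzRingType) (f : nat -> R) N :
  \prod_(0 <= i < 3 * N | (3 %| i)%N) f i = \prod_(0 <= i < N) f (3 * i)%N.
Proof.
rewrite big_mkcond; elim: N => [|N IHN]; first by rewrite !big_geq.
have -> : (3 * N.+1 = (3 * N).+3)%N by lia.
rewrite !big_nat_recr //= IHN dvdn_mulr //.
have -> : (3 %| (3 * N).+1)%N = false by lia.
have -> : (3 %| (3 * N).+2)%N = false by lia.
by rewrite !mulr1.
Qed.

(** At an index [3i] the factor is [3X + 6i - 3N], three times [clin N i]; the other indices form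
    the last factor. *)
Lemma clin_prodT_triple N :
  clin_prod xpredT (3 * N) \Po (3 * 'X) =
    3 ^+ N * clin_prod xpredT N * (clin_prod (fun i => ~~ (3 %| i)%N) (3 * N) \Po (3 * 'X)).
Proof.
rewrite {1}/clin_prod (bigID (fun i => 3 %| i)%N) /= prod_dvdn3 comp_polyM.
congr (_ * _); rewrite rmorph_prod /=.
rewrite (eq_bigr (fun i => 3 * clin N i)) => [|i _].
  by rewrite big_split /= prodr_const_nat subn0.
rewrite /clin comp_polyD comp_polyX rmorphB !rmorph_nat !natrM; ring.
Qed.

(** The map [i -> N - i] negates the constants. Index 0 is excluded because its partner [N] lies
    outside the range. The sign exponent counts the admissible indices. *)
Lemma clin_prod_reflect (P : pred nat) N : P 0%N = false ->
  (forall i, (0 < i < N)%N -> P (N - i)%N = P i) ->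
  exists j, clin_prod P N \Po - 'X = (-1) ^+ j * clin_prod P N.
Proof.
move=> P0 PN; case: N PN => [|N] PN.
  by exists 0%N; rewrite /clin_prod !big_geq // expr0 mul1r rmorph1.
exists (\sum_(1 <= i < N.+1 | P i) 1)%N.
rewrite /clin_prod big_ltn_cond // P0 rmorph_prod -prodrXr.
have -> : \prod_(1 <= i < N.+1 | P i) clin N.+1 i =
    \prod_(1 <= i < N.+1 | P i) clin N.+1 (N.+1 - i).
  rewrite big_nat_rev big_nat_cond [RHS]big_nat_cond.
  by apply: eq_big => [i|i _]; [apply: andb_id2l => /PN <-; congr P|congr clin]; lia.
rewrite -big_split [LHS]big_nat_cond [RHS]big_nat_cond.
apply: eq_bigr => i /andP[/andP[_ i_lt] _] /=; rewrite expr1.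
rewrite /clin comp_polyD comp_polyX rmorphB !rmorph_nat mulnBr natrB; last lia.
by rewrite natrM; ring.
Qed.

(** Iterated tripling: [R] collects the factors prime to 3, each evaluated at a multiple of 3, where
    [X ^+ 2 - 1] is [-1] modulo 3 and its power is a sign modulo a high power of 3. *)
Lemma clin_prodT_factor a m c : a = 1%N \/ a = 2%N ->
  exists R j k,
  [/\ clin_prod xpredT (a * 3 ^ (m.+1 + c)) \Po (3 ^+ c * 'X) =
        3 ^+ (\sum_(i < c) a * 3 ^ (m.+1 + i)) * clin_prod xpredT (a * 3 ^ m.+1) * R,
      cong (3 ^+ m.+1) R ((-1) ^+ j) & R \Po - 'X = (-1) ^+ k * R].
Proof.
move=> ha; elim: c => [|c [R [j [k [factor Rj Rk]]]]].
  exists 1, 0%N, 0%N.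
  rewrite big_ord0 addn0 !expr0 !mul1r mulr1 comp_polyXr.
  by split; [|exact: cong_refl|rewrite rmorph1].
pose N := (a * 3 ^ (m.+1 + c))%N.
have N3 : (a * 3 ^ (m.+1 + c.+1) = 3 * N)%N by rewrite addnS expnS mulnCA.
pose Q := clin_prod (fun i => ~~ (3 %| i)%N) (3 * N).
have [l Ql] : exists l, Q \Po - 'X = (-1) ^+ l * Q.
  by apply: clin_prod_reflect => // i i_lt; rewrite dvdn_subr ?dvdn_mulr; lia.
exists (R * (Q \Po (3 ^+ c.+1 * 'X))), (j + N)%N, (k + l)%N; split.
- have -> : 3 ^+ c.+1 * 'X = (3 * 'X) \Po (3 ^+ c * 'X) :> {poly int}.
    by rewrite comp_polyM comp_polyX rmorph_nat exprS mulrA.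
  rewrite N3 !comp_polyA clin_prodT_triple !comp_polyM factor rmorphXn rmorph_nat.
  by rewrite big_ord_recr exprD /= -/N -/Q; ring.
- rewrite exprD; apply: congM => //.
  apply: (@cong_dvd _ _ (3 ^+ c.+1)); rewrite -exprD addnS.
  apply: (@cong_trans _ _ _ ((('X ^+ 2 - 1) ^+ N) \Po (3 ^+ c.+1 * 'X))).
    by rewrite /Q -N3 addnS; apply: cong_comp; apply: clin_prod_coprime3_cong.
  rewrite rmorphXn rmorphB rmorph1 /= comp_Xn_poly /N !exprM.
  apply/cong_exp3/congX; exists (3 * (3 ^+ c * 'X) ^+ 2).
  by rewrite [3 ^+ _.+1]exprS; ring.
- rewrite comp_polyM Rk -comp_polyA exprD.
  have -> : (3 ^+ c.+1 * 'X) \Po - 'X = - 'X \Po (3 ^+ c.+1 * 'X) :> {poly int}.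
    by rewrite comp_polyM comp_polyX rmorphXn rmorph_nat rmorphN /= comp_polyX mulrN.
  by rewrite comp_polyA Ql comp_polyM rmorphXn rmorphN rmorph1; ring.
Qed.

(** * Taylor coefficients and exact 3-adic valuations *)

Lemma coef_comp_poly_linear {R : comNzRingType} (p : {poly R}) d c r :
  (p \Po (d%:P * 'X + c%:P))`_r = d ^+ r * p^`N(r).[c].
Proof.
elim/poly_ind: p r => [|p k IHp] r.
  by rewrite comp_poly0 linear0 horner0 coef0 mulr0.
rewrite comp_poly_MXaddC; set q := _ \Po _ in IHp *.
have -> : q * (d%:P * 'X + c%:P) + k%:P = d%:P * (q * 'X) + c%:P * q + k%:P by ring.
rewrite !coefD !coefCM coefMX coefC; case: r => [|r].
  by rewrite IHp !nderivn0 hornerMXaddC expr0 /=; ring.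
by rewrite !IHp nderivnMXaddC hornerD hornerMX exprS /=; ring.
Qed.

Lemma coef_comp_polyCX {R : comNzRingType} (p : {poly R}) d r :
  (p \Po (d%:P * 'X))`_r = d ^+ r * p`_r.
Proof.
have := coef_comp_poly_linear p d 0 r; rewrite addr0 => ->.
by rewrite horner_coef0 coef_nderivn addn0 binn.
Qed.

(** This says [v_3(x) = v] and forces [x] to be nonzero, unlike [logn 3 x = v], since
    [logn 3 0 = 0]. *)
Definition exact3 (v : nat) (x : int) := exists2 u, ~~ (3 %| u)%Z & x = 3 ^+ v * u.

Lemma exact3M v w x y : exact3 v x -> exact3 w y -> exact3 (v + w) (x * y).
Proof.
case=> u u3 -> [t t3 ->]; exists (u * t); last by rewrite exprD; ring.
by rewrite dvdzE abszM (@Euclid_dvdM _ _ 3) // negb_or u3.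
Qed.

Lemma exact3D v w x y : (v < w)%N -> exact3 v x -> exact3 v (x + 3 ^+ w * y).
Proof.
move=> lt_vw [u u3 ->]; exists (u + 3 * (3 ^+ (w - v.+1) * y)).
  by rewrite rpredDr ?dvdz_mulr.
by rewrite mulrDr !mulrA -exprSr -exprD subnKC.
Qed.

Lemma exact3_sign i : exact3 0 ((-1) ^+ i).
Proof. by exists ((-1) ^+ i); rewrite ?mul1r ?dvdzE ?abszX ?exp1n. Qed.

Lemma exact3_2X i : exact3 0 (2 ^+ i).
Proof. by exists (2 ^+ i); rewrite ?mul1r ?dvdzE ?abszX ?(@Euclid_dvdX _ _ 3). Qed.

Lemma exact3_3X i : exact3 i (3 ^+ i).
Proof. by exists 1; rewrite ?mulr1. Qed.

Lemma exact3_nat k : (0 < k)%N -> exact3 (logn 3 k) k%:R.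
Proof.
move=> k_gt0; have [//|u u3 {2}->] := @pfactor_coprime 3 k _ k_gt0.
exists u%:R; last by rewrite natrM natrX mulrC.
by rewrite dvdzE !natz !absz_nat -prime_coprime.
Qed.

Lemma exact3_neq0 v x : exact3 v x -> x != 0.
Proof.
case=> u u3 ->; rewrite mulf_neq0 ?expf_neq0 //.
by apply: contraNneq u3 => ->.
Qed.

Lemma exact3_inj v w x : exact3 v x -> exact3 w x -> v = w.
Proof.
have logx n : exact3 n x -> logn 3 `|x|%N = n.
  case=> u u3 ->; rewrite abszM abszX lognM ?expn_gt0 //; last first.
    by rewrite absz_gt0; apply: contraNneq u3 => ->.
  by rewrite pfactorK ?logn_coprime ?addn0 ?prime_coprime.
by move=> /logx <- /logx.
Qed.

Lemma logn3_sub a m i : a = 1%N \/ a = 2%N -> (0 < i < a * 3 ^ m)%N ->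
  logn 3 (a * 3 ^ m - i) = logn 3 i.
Proof.
move=> ha /andP[i_gt0 i_lt].
have [//|u u3 i_eq] := @pfactor_coprime 3 i _ i_gt0; set v := logn 3 i in i_eq *.
have u_gt0 : (0 < u)%N by case: u u3 {i_eq}.
have le_vm : (v <= m)%N.
  rewrite -ltnS -(@ltn_exp2l 3) // expnS.
  apply: (@leq_ltn_trans i); first by rewrite i_eq leq_pmull.
  apply: (leq_trans i_lt); rewrite leq_pmul2r ?expn_gt0 //; by case: ha => ->.
have -> : (a * 3 ^ m - i = (a * 3 ^ (m - v) - u) * 3 ^ v)%N.
  by rewrite mulnBl -mulnA -expnD subnK // -i_eq.
have lt_u : (u < a * 3 ^ (m - v))%N.
  by move: i_lt; rewrite i_eq -{1}(subnK le_vm) expnD mulnA ltn_pmul2r ?expn_gt0.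
rewrite lognM ?subn_gt0 ?expn_gt0 // pfactorK // lognE.
suff -> : (3 %| a * 3 ^ (m - v) - u)%N = false by rewrite andbF.
(* If [v = m], then [u < a] forces [a = 2] and [u = 1], and the difference is 1; otherwise 3 divides
   the minuend but not [u]. *)
case: (m - v)%N lt_u => [|d] lt_u.
  by case: ha lt_u => ->; rewrite ?muln1; lia.
rewrite dvdn_subr ?(ltnW lt_u) //; last by rewrite expnS mulnCA dvdn_mulr.
by apply: negbTE; rewrite -prime_coprime.
Qed.

(** With [A = a 3^m], the identity [(e+1) C(A, e+1) = (A-e) C(A, e)] and [v_3(A-e) = v_3(e)] make
    the sum independent of [e]. *)
Lemma logn3_bin a m e : a = 1%N \/ a = 2%N -> (0 < e <= a * 3 ^ m)%N ->
  (logn 3 'C(a * 3 ^ m, e) + logn 3 e = m)%N.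
Proof.
move=> ha; case: e => // e; elim: e => [|e IHe] e_le.
  have a_gt0 : (0 < a)%N by case: ha => ->.
  by rewrite bin1 lognM ?expn_gt0 // pfactorK // logn1 addn0; case: ha => ->.
have lt_e : (0 < e.+1 < a * 3 ^ m)%N by lia.
have := congr1 (logn 3) (mul_bin_left (a * 3 ^ m) e.+1).
rewrite !lognM ?bin_gt0 ?subn_gt0 //; try lia.
rewrite (logn3_sub _ _ _ ha lt_e) => eq_log.
by rewrite addnC eq_log addnC IHe //; lia.
Qed.

(* Makes every Taylor term of order [i >= 2] negligible against the linear one. *)
Lemma logn3_bin_expn m r i : (0 < m)%N -> (1 < i)%N ->
  (logn 3 r.+1 + 2 * m <= logn 3 'C(r + i, r) + m * i)%N.
Proof.
move=> m_gt0; case: i => // i i_gt0.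
(* Here [(i+1) C(r+i+1, r) = (r+1) C(r+i+1, i)], so it suffices that [v_3(i+1) <= m (i-1)]. *)
have := congr1 (logn 3) (mul_bin_left (r + i.+1) i).
have -> : (r + i.+1 - i = r.+1)%N by lia.
rewrite !lognM ?bin_gt0 //; try lia.
rewrite -{1}bin_sub ?leq_addl // addnK => eq_log.
have log_le : (logn 3 i.+1 <= i.-1)%N.
  suff: (logn 3 i.+1 < i)%N by lia.
  rewrite -(@ltn_exp2l 3) //; apply: (@leq_ltn_trans i.+1).
    by rewrite dvdn_leq // pfactor_dvdnn.
  case: i i_gt0 {eq_log} => // i _; elim: i => // i IHi.
  rewrite expnS; lia.
have : (logn 3 i.+1 <= m * i.-1)%N by apply: (leq_trans log_le); rewrite leq_pmull.
case: i i_gt0 eq_log {log_le} => // i _ eq_log /=; rewrite !mulnS; lia.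
Qed.

(** * Valuation of the Stirling numbers *)

Lemma coef_X3BX_exp M e : (e <= M)%N ->
  (('X ^+ 3 - 'X : {poly int}) ^+ M)`_(3 * M - 2 * e) = (-1) ^+ e * 'C(M, e)%:R.
Proof.
move=> le_eM.
have lt_eM : (e < M.+1)%N by [].
rewrite exprBn coef_sum (bigD1 (Ordinal lt_eM)) //= big1 => [|i ne_ie].
  rewrite addr0 coefMn -mulrA -exprM -exprD.
  by rewrite -polyCN -polyC_exp coefCM coefXn (_ : _ == _) ?mulr1 ?mulr_natr //; lia.
rewrite coefMn -mulrA -exprM -exprD -polyCN -polyC_exp coefCM coefXn.
rewrite (_ : _ == _ = false) ?mulr0 ?mul0rn //.
have := ltn_ord i; move: ne_ie; rewrite -val_eqE /=; lia.
Qed.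

Lemma horner_split2 (q : {poly int}) x d :
  (forall i, (1 < i)%N -> exists h, q`_i * x ^+ i = d * h) ->
  exists h, q.[x] = q`_0 + q`_1 * x + d * h.
Proof.
(* Padding by two zero coefficients lets two terms be split off whatever the size of [q]. *)
move=> dvd_q; have qx : q.[x] = \sum_(i < (size q).+2) q`_i * x ^+ i.
  by apply: horner_coef_wide; lia.
rewrite qx !big_ord_recl expr0 mulr1 expr1 addrA /=.
suff [h ->] : exists h, \sum_(i < size q) q`_i.+2 * x ^+ i.+2 = d * h by exists h.
elim/big_ind: _ => [|y z [h ->] [g ->]|i _]; last exact: dvd_q.
  by exists 0; rewrite mulr0.
by exists (h + g); rewrite mulrDr.
Qed.

Lemma clin_prod_shift (N : nat) :
  clin_prod xpredT N \Po (2 * 'X + N%:R) = 2 ^+ N * \prod_(0 <= i < N) ('X + i%:R).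
Proof.
rewrite /clin_prod rmorph_prod -[in 2 ^+ N](subn0 N) -prodr_const_nat -big_split.
apply: eq_bigr => i _ /=.
by rewrite /clin comp_polyD comp_polyX rmorphB !rmorph_nat natrM; ring.
Qed.

(** Here [B = T * R], with [T] the centred product without its factor ['X - M]. That factor becomes
    [2 * 'X] at [2 * 'X + M], whence the index shift from [r.+1] to [r]. *)
Lemma stirling1_centered a m c : a = 1%N \/ a = 2%N ->
  exists (B : {poly int}) l,
  [/\ forall r, 2 ^+ (a * 3 ^ (m.+1 + c)) * 3 ^+ (c * r.+1) *
          (stirling1 (a * 3 ^ (m.+1 + c)) r.+1)%:R =
        3 ^+ (\sum_(i < c) a * 3 ^ (m.+1 + i)) * 2 *
          (B \Po (2 * 'X + (a * 3 ^ m.+1)%:R))`_r,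
      forall r e, (0 < e <= a * 3 ^ m)%N -> (r.+1 + 2 * e = a * 3 ^ m.+1)%N ->
        exact3 (m - logn 3 e) B`_r
    & B \Po - 'X = (-1) ^+ l * B].
Proof.
move=> ha; have [R [j [k [factor Rj Rk]]]] := clin_prodT_factor a m c ha.
set N := (a * 3 ^ (m.+1 + c))%N in factor *; set S := (\sum_(i < c) _)%N in factor *.
set M := (a * 3 ^ m.+1)%N in factor *.
pose T := clin_prod (fun i => i != 0%N) M.
have [l Tl] : exists l, T \Po - 'X = (-1) ^+ l * T.
  by apply: clin_prod_reflect => // i; lia.
have M_gt0 : (0 < M)%N by rewrite muln_gt0 expn_gt0; case: ha => ->.
have UT : clin_prod xpredT M = ('X - M%:R) * T.
  rewrite /T /clin_prod [LHS]big_ltn // [in RHS]big_ltn_cond //= {1}/clin muln0 sub0r.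
  by congr (_ * _); rewrite big_nat [RHS]big_nat_cond; apply: eq_bigl => i; lia.
have NM : (N = M * 3 ^ c)%N by rewrite /N expnD mulnA.
exists (T * R), (l + k)%N; split.
- move=> r; have /(congr1 (fun p : {poly int} => (p \Po (2 * 'X + M%:R))`_r.+1)) := factor.
  rewrite UT !comp_polyM comp_polyB comp_polyX !rmorphXn !rmorph_nat addrK.
  rewrite -!comp_polyA.
  have -> : (3 ^+ c * 'X) \Po (2 * 'X + M%:R) =
      (2 * 'X + N%:R) \Po ((3 ^+ c)%:P * 'X) :> {poly int}.
    rewrite !comp_polyD !comp_polyM !comp_polyX !rmorph_nat rmorphXn rmorph_nat.
    by rewrite polyC_exp polyC_natr NM natrM natrX; ring.
  rewrite comp_polyA clin_prod_shift comp_polyM rmorphXn rmorph_nat.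
  have -> : 2 ^+ N = (2 ^+ N)%:P :> {poly int} by rewrite polyC_exp polyC_natr.
  rewrite coefCM coef_comp_polyCX coef_prod_XaddC -exprM -[X in _ -> X = _]mulrA => ->.
  have -> : 3 ^+ S * (2 * 'X * (T \Po (2 * 'X + M%:R))) * (R \Po (2 * 'X + M%:R)) =
    (3 ^+ S * 2)%:P * ('X * ((T * R) \Po (2 * 'X + M%:R))).
    by rewrite comp_polyM polyCM polyC_exp !polyC_natr; ring.
  by rewrite coefCM coefXM comp_polyM.
- move=> r e e_le r_eq.
  have : cong (3 ^+ m.+1) ('X * (T * R)) (('X ^+ 3 - 'X) ^+ (a * 3 ^ m) * (-1) ^+ j).
    rewrite mulrA; apply: congM => //.
    apply: (@cong_trans _ _ _ (clin_prod xpredT M)); last exact: clin_prodT_cong.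
    (* Replacing ['X - M] by ['X] costs [M * T], a multiple of [3 ^+ m.+1]. *)
    by exists (a%:R * T); rewrite UT natrM natrX; ring.
  case=> h /(congr1 (fun p : {poly int} => p`_r.+1)).
  have -> : (-1) ^+ j = ((-1) ^+ j)%:P :> {poly int} by rewrite polyC_exp polyCN.
  have -> : 3 ^+ m.+1 = (3 ^+ m.+1)%:P :> {poly int} by rewrite polyC_exp polyC_natr.
  rewrite coefXM coefD coefMC coefCM /= => ->.
  have -> : (r.+1 = 3 * (a * 3 ^ m) - 2 * e)%N by rewrite mulnCA -expnS; lia.
  case/andP: (e_le) => e_gt0 e_leM; rewrite coef_X3BX_exp //.
  apply: exact3D; first by rewrite ltnS leq_subr.
  have -> : (m - logn 3 e = 0 + logn 3 'C(a * 3 ^ m, e) + 0)%N.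
    by have := logn3_bin _ _ _ ha e_le; lia.
  by do 2?[apply: exact3M]; rewrite ?bin_gt0; (exact: exact3_sign || apply: exact3_nat);
    rewrite bin_gt0.
by rewrite comp_polyM Tl Rk exprD; ring.
Qed.

(** An even or odd polynomial has no two adjacent nonzero coefficients. *)
Lemma reflected_coef_eq0 (B : {poly int}) l r :
  B \Po - 'X = (-1) ^+ l * B -> B`_r.+1 != 0 -> B`_r = 0.
Proof.
move=> Bl B_neq0.
have coefB i : (-1) ^+ i * B`_i = (-1) ^+ l * B`_i.
  have := congr1 (fun p : {poly int} => p`_i) Bl.
  have -> : - 'X = (-1)%:P * 'X :> {poly int} by rewrite polyCN mulN1r.
  have -> : (-1) ^+ l = ((-1) ^+ l)%:P :> {poly int} by rewrite polyC_exp polyCN.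
  by rewrite coef_comp_polyCX coefCM.
have /(mulIf B_neq0) sign_l := coefB r.+1.
have := coefB r; rewrite -sign_l exprS mulN1r mulNr => eq_opp.
apply: (mulfI (negbT (signr_eq0 _ r))); rewrite mulr0; lia.
Qed.

(** The exponent is written [m.+1], and the negative terms of the formula are moved to the left, to
    stay within [nat]. *)
Lemma logn3_stirling1 a m c k : a = 1%N \/ a = 2%N ->
  (2 <= k <= 2 * (a * 3 ^ m) + 1)%N -> (k < a * 3 ^ m.+1)%N ->
  (logn 3 (stirling1 (a * 3 ^ (m.+1 + c)) (a * 3 ^ m.+1 - k)) +
     c * (a * 3 ^ m.+1 - k) + logn 3 k./2 =
   \sum_(i < c) a * 3 ^ (m.+1 + i) + m + (m.+1 + logn 3 k) * odd k)%N.
Proof.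
move=> ha hk k_lt; have [B [l [coef_stirling coefB Bl]]] := stirling1_centered a m c ha.
set M := (a * 3 ^ m.+1)%N in k_lt coef_stirling coefB *.
set N := (a * 3 ^ (m.+1 + c))%N in coef_stirling *.
set S := (\sum_(i < c) _)%N in coef_stirling *.
have k2_bounds : (0 < k./2 <= a * 3 ^ m)%N by lia.
have logn_k2 : (logn 3 k./2 <= m)%N.
  by have := logn3_bin _ _ _ ha k2_bounds; lia.
have a_gt0 : (0 < a)%N by case: ha => ->.
have logn_M : logn 3 M = m.+1.
  by rewrite lognM ?expn_gt0 // pfactorK //; case: ha => ->.
have M_gt0 : (0 < M)%N by rewrite muln_gt0 a_gt0 expn_gt0.
pose r := (M - k).-1; have r_eq : (M - k = r.+1)%N by rewrite /r; lia.
have logn_r : logn 3 r.+1 = logn 3 k.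
  by rewrite -r_eq logn3_sub //; apply/andP; lia.
pose w := (m - logn 3 k./2 + (m.+1 + logn 3 k) * odd k)%N.
suff exact_w : exact3 w (B \Po (2 * 'X + M%:R))`_r.
  (* As [logn 3 0 = 0], the number must be known to be nonzero before valuations are compared. *)
  have s_gt0 : (0 < stirling1 N r.+1)%N.
    rewrite lt0n; apply/eqP => s0; have := coef_stirling r.
    rewrite s0 mulr0 => /esym/eqP; apply/negP.
    by rewrite !mulf_neq0 ?expf_neq0 // (exact3_neq0 _ _ exact_w).
  have := exact3M _ _ _ _ (exact3M _ _ _ _ (exact3_2X N) (exact3_3X (c * r.+1)))
    (exact3_nat _ s_gt0).
  rewrite coef_stirling => /exact3_inj.
  move/(_ _ (exact3M _ _ _ _ (exact3M _ _ _ _ (exact3_3X S) (exact3_2X 1)) exact_w)).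
  rewrite r_eq /w; lia.
have -> : 2 * 'X + M%:R = 2%:P * 'X + (M%:R)%:P :> {poly int}.
  by rewrite !rmorph_nat.
rewrite coef_comp_poly_linear; set q := B^`N(r).
rewrite -[w]add0n; apply: exact3M; first exact: exact3_2X.
have q0 : q`_0 = B`_r by rewrite coef_nderivn addn0 binn.
have q1 : q`_1 = B`_r.+1 * r.+1%:R.
  by rewrite coef_nderivn addn1 binSn mulr_natr.
have [u u3 M_eq] := exact3_nat _ M_gt0; rewrite logn_M in M_eq.
have [h ->] : exists h, q.[M%:R] = q`_0 + q`_1 * M%:R + 3 ^+ (logn 3 r.+1 + 2 * m.+1) * h.
  apply: horner_split2 => i i_gt1; rewrite coef_nderivn M_eq -[B`__ *+ _]mulr_natr.
  have bin_pos : (0 < 'C(r + i, r))%N by rewrite bin_gt0 leq_addr.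
  have [t _ ->] := exact3_nat _ bin_pos.
  have := logn3_bin_expn m.+1 r i isT i_gt1.
  set v := logn 3 'C(_, _); set d := (_ + 2 * _)%N => le_d.
  exists (B`_(r + i) * t * u ^+ i * 3 ^+ (v + m.+1 * i - d)).
  have := subnKC le_d; set y := (_ - d)%N => d_eq.
  transitivity (B`_(r + i) * t * u ^+ i * 3 ^+ (v + m.+1 * i)); last first.
    by rewrite -d_eq exprD; ring.
  by rewrite exprMn -exprM exprD; ring.
(* The index [e = k./2] belongs to the coefficient [r.+1] of [B] for odd [k], and to the coefficient
   [r] for even [k]. *)
rewrite q0 q1 logn_r /w; case: (boolP (odd k)) => odd_k.
  have coef_r1 : exact3 (m - logn 3 k./2) B`_r.+1 by apply: coefB => //; lia.
  rewrite (reflected_coef_eq0 _ _ _ Bl (exact3_neq0 _ _ coef_r1)) add0r.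
  apply: exact3D; first lia.
  have -> : (m - logn 3 k./2 + (m.+1 + logn 3 k) * true =
    m - logn 3 k./2 + logn 3 r.+1 + logn 3 M)%N by rewrite logn_r logn_M; lia.
  by apply: exact3M (exact3_nat _ M_gt0); apply: exact3M (exact3_nat _ _).
have coef_r : exact3 (m - logn 3 k./2) B`_r by apply: coefB => //; lia.
(* For even [k] everything but the constant term is divisible by [3 ^+ m.+1], beyond its valuation,
   which is at most [m]. *)
rewrite muln0 addn0 M_eq.
have -> : (logn 3 k + 2 * m.+1 = m.+1 + (logn 3 k + m.+1))%N by lia.
rewrite exprD -addrA.
have -> : B`_r.+1 * r.+1%:R * (3 ^+ m.+1 * u) + 3 ^+ m.+1 * 3 ^+ (logn 3 k + m.+1) * h =
  3 ^+ m.+1 * (B`_r.+1 * r.+1%:R * u + 3 ^+ (logn 3 k + m.+1) * h) by ring.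
by apply: exact3D coef_r; lia.
Qed.

(** This geometric sum is [(N - M)/2], doubled to avoid division. *)
Lemma sum_expn3 a m c :
  (2 * \sum_(i < c) a * 3 ^ (m + i) + a * 3 ^ m = a * 3 ^ (m + c))%N.
Proof.
elim: c => [|c IHc]; first by rewrite big_ord0 addn0.
by rewrite big_ord_recr /= mulnDr addnAC IHc addnS expnS mulnCA; lia.
Qed.

Theorem theorem1p1 (a n m k : nat)
  (ha : a = 1%N \/ a = 2%N)
  (hm : (1 <= m <= n)%N)
  (hk2 : (2 <= k <= 2 * a * 3 ^ m.-1 + 1)%N)
  (hk : (k < a * 3 ^ m)%N) :
  (logn 3 (stirling1 (a * 3 ^ n)%N (a * 3 ^ m - k)%N))%:R
  = a%:R / 2 * (3 ^+ n - 3 ^+ m)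
    - (n%:R - m%:R) * (a%:R * 3 ^+ m - k%:R)
    + m%:R - 1
    - (logn 3 (k %/ 2))%:R
    + (m%:R + (logn 3 k)%:R) * (eps k)%:R :> rat.
Proof.
case: m hm hk2 hk => // m; case/andP=> _ le_mn hk2 hk.
have [c n_eq] : exists c, n = (m.+1 + c)%N by exists (n - m.+1)%N; lia.
rewrite /= -mulnA in hk2.
have := logn3_stirling1 a m c k ha hk2 hk.
have := sum_expn3 a m.+1 c; rewrite -n_eq.
move/(congr1 (fun x => x%:R : rat)); rewrite natrD !natrM !natrX => sum_eq.
move/(congr1 (fun x => x%:R : rat)).
rewrite divn2 (_ : eps k = odd k) //.
rewrite !natrD !natrM natrD natrB; last exact: ltnW.
rewrite natrM natrX => log_eq.
have n_eq' : n%:R = m.+1%:R + c%:R :> rat by rewrite n_eq natrD.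
have m_eq : m.+1%:R = m%:R + 1 :> rat by rewrite -addn1 natrD.
rewrite n_eq' m_eq in log_eq sum_eq *.
nra.
Qed.
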